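(* Let $(G,\Lambda)$ be a pseudo free self-similar $k$-graph over a row-finite source-free $k$-graph $\Lambda$. Then $\psi:\mathcal{G}_{\mathrm{tight}}(\mathcal{S}_{G,\Lambda})\to\mathcal{G}_{G,\Lambda}$ defined by $$[F,\nu x]\longmapsto\big(\mu(g\cdot x);\mathcal{T}_{d(\mu)}([\varphi(g,x)]),\,d(\mu)-d(\nu);\,\nu x\big),$$ where $(\mu,g,\nu)$ is the unique triple in $F$ with $\nu$ as the third part, is an isomorphism from $\mathcal{G}_{\mathrm{tight}}(\mathcal{S}_{G,\Lambda})$ onto $\mathcal{G}_{G,\Lambda}$ as topological groupoids.
   Context: **$k$-graphs.** A $k$-graph is a countable small category $\Lambda$ with a functor $d:\Lambda\to\mathbb{N}^k$ (degree) with the unique factorisation property: if $d(\lambda)=m+n$ there are unique $\mu,\nu$ with $d(\mu)=m$, $d(\nu)=n$, $\lambda=\mu\nu$. $\Lambda^n=d^{-1}(n)$; $\Lambda^0$ is identified with the objects (vertices); $r,s$ are range and source, and $\mu\nu$ is defined iff $s(\mu)=r(\nu)$. $v\Lambda^n=\{\lambda\in\Lambda^n:r(\lambda)=v\}$. $\Lambda$ is row-finite if $|v\Lambda^{e_i}|<\infty$, and source-free if $v\Lambda^{e_i}\neq\emptyset$, for all $v\in\Lambda^0$, $1\le i\le k$ ($e_i$ the standard generators of $\mathbb{N}^k$). With $\vee$ the coordinatewise maximum, $\Lambda^{\min}(\mu,\nu)=\{(\alpha,\beta):\mu\alpha=\nu\beta,\ d(\mu\alpha)=d(\mu)\vee d(\nu)\}$.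 $\Lambda^\infty$ is the set of infinite paths: degree-preserving functors $x$ from the $k$-graph $\{(p,q)\in\mathbb{N}^k\times\mathbb{N}^k:p\le q\}$ (with $d(p,q)=q-p$) to $\Lambda$; $r(x)=x(0,0)$, $v\Lambda^\infty=\{x\in\Lambda^\infty:r(x)=v\}$; $\lambda x$ denotes concatenation when $s(\lambda)=r(x)$. **Self-similar $k$-graph** $(G,\Lambda)=(G,\Lambda,\varphi)$: a $k$-graph $\Lambda$ (here row-finite and source-free), a countable discrete group $G$ with identity $e_G$, an action of $G$ on $\Lambda$ by degree-preserving bijections commuting with $r$ and $s$, and a map $\varphi:G\times\Lambda\to G$ such that for all $g,h\in G$, $\mu,\nu\in\Lambda$ (with $s(\mu)=r(\nu)$ where $\mu\nu$ occurs), $v\in\Lambda^0$: $\varphi(gh,\mu)=\varphi(g,h\cdot\mu)\varphi(h,\mu)$; $g\cdot(\mu\nu)=(g\cdot\mu)(\varphi(g,\mu)\cdot\nu)$; $\varphi(g,\mu\nu)=\varphi(\varphi(g,\mu),\nu)$; $\varphi(g,v)=g$. $G$ acts on $\Lambda^\infty$ by $(g\cdot x)(0,n)=g\cdot(x(0,n))$. $(G,\Lambda)$ is pseudo free if $g\cdot\mu=\mu$ and $\varphi(g,\mu)=e_G$ for some $\mu\in\Lambda$ imply $g=e_G$. **$\mathcal{S}_{G,\Lambda}$**: elements are the finite sets $F$ of triples $(\mu,g,\nu)\in\Lambda\times G\times\Lambda$ with $s(\mu)=g\cdot s(\nu)$, such that any two distinct triples $(\mu,g,\nu),(\xi,h,\eta)\in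 F$ satisfy $\Lambda^{\min}(\mu,\xi)=\Lambda^{\min}(\nu,\eta)=\emptyset$. Multiplication: $EF=\bigcup_{(\mu,g,\nu)\in E,(\xi,h,\eta)\in F}\{(\mu(g\cdot\alpha),\varphi(g,\alpha)\varphi(h,h^{-1}\cdot\beta),\eta(h^{-1}\cdot\beta)):(\alpha,\beta)\in\Lambda^{\min}(\nu,\xi)\}$; $F^*=\{(\nu,g^{-1},\mu):(\mu,g,\nu)\in F\}$; zero is $\emptyset$. It is an inverse semigroup; $\mathcal{E}(\mathcal{S}_{G,\Lambda})$ denotes its idempotents (sets of triples of the form $(\mu,e_G,\mu)$). **Tight groupoid** (in this row-finite source-free setting). The tight spectrum of $\mathcal{S}_{G,\Lambda}$ is identified with $\Lambda^\infty$, with topology generated by $Z(\lambda)=\{\lambda y:y\in s(\lambda)\Lambda^\infty\}$, $x\in\Lambda^\infty$ corresponding to the filter of idempotents $E$ with $(x(0,n),e_G,x(0,n))\in E$ for some $n\in\mathbb{N}^k$. $F\in\mathcal{S}_{G,\Lambda}$ acts by $\theta_F(\nu x)=\mu(g\cdot x)$ for $(\mu,g,\nu)\in F$, $x\in s(\nu)\Lambda^\infty$. $\mathcal{G}_{\mathrm{tight}}(\mathcal{S}_{G,\Lambda})$ is the groupoid of germs $[F,\nu x]$ ($(\mu,g,\nu)\in F$, $x\in s(\nu)\Lambda^\infty$), with $[F,y]=[F',y']$ iff $y=y'$ and there is $E\in\mathcal{E}(\mathcal{S}_{G,\Lambda})$ such that $y\in Z(\lambda)$ for some $(\lambda,e_G,\lambda)\in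 E$ and $FE=F'E$; $s([F,y])=y$, $r([F,y])=\theta_F(y)$, $[F',\theta_F(y)][F,y]=[F'F,y]$; topology generated by the sets $\{[F,\nu x]:x\in s(\nu)\Lambda^\infty\}$ ($(\mu,g,\nu)\in F\in\mathcal{S}_{G,\Lambda}$). **The groupoid $\mathcal{G}_{G,\Lambda}$.** $C(\mathbb{N}^k,G)$ is the group of maps $f:\mathbb{N}^k\to G$ under pointwise multiplication; $f\sim h$ iff there is $n_0$ with $f(n)=h(n)$ for all $n\ge n_0$; $Q(\mathbb{N}^k,G)=C(\mathbb{N}^k,G)/{\sim}$. For $z\in\mathbb{Z}^k$, $\mathcal{T}_z(f)(n)=f(n-z)$ if $n-z\ge0$ and $e_G$ otherwise; this induces an automorphism $\mathcal{T}_z$ of $Q(\mathbb{N}^k,G)$ and an action $\mathcal{T}$ of $\mathbb{Z}^k$, giving the semidirect product $Q(\mathbb{N}^k,G)\rtimes_{\mathcal{T}}\mathbb{Z}^k$. For $g\in G$, $x\in\Lambda^\infty$, $\varphi(g,x)\in C(\mathbb{N}^k,G)$ is $n\mapsto\varphi(g,x(0,n))$. $\mathcal{G}_{G,\Lambda}$ is the subgroupoid $$\{(\mu(g\cdot x);\mathcal{T}_{d(\mu)}([\varphi(g,x)]),d(\mu)-d(\nu);\nu x):g\in G,\ \mu,\nu\in\Lambda,\ s(\mu)=g\cdot s(\nu),\ x\in s(\nu)\Lambda^\infty\}$$ of $\Lambda^\infty\times(Q(\mathbb{N}^k,G)\rtimes_{\mathcal{T}}\mathbb{Z}^k)\times\Lambda^\infty$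 (with $r(x;q;y)=x$, $s(x;q;y)=y$, $(x;q;y)(y;q';z)=(x;qq';z)$), with topology generated by the sets $Z(\mu,g,\nu)$ obtained by fixing $\mu,g,\nu$ and letting $x$ range over $s(\nu)\Lambda^\infty$. *)

(* Defs.v *)
From HB Require Import structures.
From mathcomp Require Import all_boot all_order all_algebra.
From mathcomp Require Import boolp classical_sets functions cardinality topology.

Set Implicit Arguments.
Unset Strict Implicit.
Unset Printing Implicit Defensive.

Import Order.TTheory GRing.Theory Num.Theory.

Local Open Scope classical_set_scope.
Local Open Scope quotient_scope.

Notation Nk k := {ffun 'I_k -> nat}.
Notation Zk k := {ffun 'I_k -> int}.

Section Multidegrees.
Variable k : nat.
Implicit Types m n : Nk k.

Definition unitN (i : 'I_k) : Nk k := [ffun j => (j == i) : nat].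
Definition leN m n : bool := [forall i, (m i <= n i)%N].
Definition joinN m n : Nk k := [ffun i => maxn (m i) (n i)].
Definition toZ n : Zk k := [ffun i => Posz (n i)].

End Multidegrees.

(* A small category in single-sorted form: an object is represented by its
   identity morphism, so [rge] and [src] take values in the vertices, which are
   the morphisms of degree 0.  [comp] is total, but [comp mu nu] is meaningful
   only when [src mu = rge nu]; its other values are never used. *)
Record kgraph (k : nat) := KGraph {
  path :> Type;
  rge : path -> path;
  src : path -> path;
  comp : path -> path -> path;
  deg : path -> Nk k;
  countable_path : countable [set: path];
  rge_rge : forall l, rge (rge l) = rge l;
  src_rge : forall l, src (rge l) = rge l;
  rge_src : forall l, rge (src l) = src l;
  src_src : forall l, src (src l) = src l;
  rge_comp : forall l m, src l = rge m -> rge (comp l m) = rge l;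
  src_comp : forall l m, src l = rge m -> src (comp l m) = src m;
  comp_rge : forall l, comp (rge l) l = l;
  comp_src : forall l, comp l (src l) = l;
  compA : forall l m n, src l = rge m -> src m = rge n ->
    comp l (comp m n) = comp (comp l m) n;
  deg_rge : forall l, deg (rge l) = 0%R;
  deg_src : forall l, deg (src l) = 0%R;
  deg_comp : forall l m, src l = rge m -> deg (comp l m) = (deg l + deg m)%R;
  factorisation : forall l (m n : Nk k), deg l = (m + n)%R ->
    exists! p : path * path,
      [/\ deg p.1 = m, deg p.2 = n, src p.1 = rge p.2 & l = comp p.1 p.2]
}.

Definition vertex k (L : kgraph k) : set L := [set v | deg v = 0%R].

Definition paths_from k (L : kgraph k) (v : L) (n : Nk k) : set L :=
  [set l | rge l = v /\ deg l = n].

Definition row_finite k (L : kgraph k) :=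
  forall (v : L) (i : 'I_k), vertex v -> finite_set (paths_from v (unitN i)).

Definition source_free k (L : kgraph k) :=
  forall (v : L) (i : 'I_k), vertex v -> paths_from v (unitN i) !=set0.

Definition Lmin k (L : kgraph k) (mu nu : L) : set (L * L) :=
  [set ab | [/\ src mu = rge ab.1, src nu = rge ab.2,
                comp mu ab.1 = comp nu ab.2 &
                deg (comp mu ab.1) = joinN (deg mu) (deg nu)]].

(* An infinite path [x], that is, a degree-preserving functor to [L] from the
   k-graph of the pairs [(p, q)] with [p <= q].  The morphism [(p, p + n)] is
   encoded by [p] and its degree [n]: [x p n] is what is usually written
   x(p, p + n), and in particular x(0, n) is [x 0 n]. *)
Record infpath k (L : kgraph k) := InfPath {
  segment :> Nk k -> Nk k -> L;
  deg_segment : forall p n, deg (segment p n) = n;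
  rge_segment : forall p n, rge (segment p n) = segment p 0%R;
  src_segment : forall p n, src (segment p n) = segment (p + n)%R 0%R;
  comp_segment : forall p m n,
    segment p (m + n)%R = comp (segment p m) (segment (p + m)%R n)
}.

HB.instance Definition _ k (L : kgraph k) := gen_eqMixin (infpath L).
HB.instance Definition _ k (L : kgraph k) := gen_choiceMixin (infpath L).

Definition inf_rge k (L : kgraph k) (x : infpath L) : L := x 0%R 0%R.

(* The concatenation l x: the unique infinite path that starts with [l] and
   whose shift by [deg l] is [x].  It is meaningful when [src l = inf_rge x]. *)
Definition concat k (L : kgraph k) (l : L) (x : infpath L) : infpath L :=
  xget x [set y : infpath L | y 0%R (deg l) = l /\
                              forall p n, y (deg l + p)%R n = x p n].

Definition cylinder k (L : kgraph k) (l : L) : set (infpath L) :=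
  [set y | exists2 x, src l = inf_rge x & y = concat l x].

(* The first half of [act_comp] says that the right-hand side of its second
   half is a composite of composable paths. *)
Record selfsimilar (k : nat) (G : groupType) (L : kgraph k) := SelfSimilar {
  act : G -> L -> L;
  cocycle : G -> L -> G;
  act1 : forall l, act 1%g l = l;
  actM : forall g h l, act (g * h)%g l = act g (act h l);
  deg_act : forall g l, deg (act g l) = deg l;
  rge_act : forall g l, rge (act g l) = act g (rge l);
  src_act : forall g l, src (act g l) = act g (src l);
  cocycleM : forall g h l,
    cocycle (g * h)%g l = (cocycle g (act h l) * cocycle h l)%g;
  act_comp : forall g mu nu, src mu = rge nu ->
    src (act g mu) = rge (act (cocycle g mu) nu) /\
    act g (comp mu nu) = comp (act g mu) (act (cocycle g mu) nu);
  cocycle_comp : forall g mu nu, src mu = rge nu ->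
    cocycle g (comp mu nu) = cocycle (cocycle g mu) nu;
  cocycle_vertex : forall g v, vertex v -> cocycle g v = g
}.

Definition pseudo_free k (G : groupType) (L : kgraph k) (S : selfsimilar G L) :=
  forall g mu, act S g mu = mu -> cocycle S g mu = 1%g -> g = 1%g.

(* g x is the unique infinite path with (g x)(0, n) = g (x(0, n)). *)
Definition inf_act k (G : groupType) (L : kgraph k) (S : selfsimilar G L)
    (g : G) (x : infpath L) : infpath L :=
  xget x [set y : infpath L | forall n, y 0%R n = act S g (x 0%R n)].

Section Semigroup.
Variables (k : nat) (G : groupType) (L : kgraph k) (S : selfsimilar G L).

Definition triple : Type := (L * G * L)%type.

Implicit Types (E F : set triple) (y : infpath L).

Definition SGL : set (set triple) :=
  [set F | [/\ finite_set F,
    forall mu g nu, F (mu, g, nu) -> src mu = act S g (src nu) &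
    forall mu g nu xi h eta, F (mu, g, nu) -> F (xi, h, eta) ->
      (mu, g, nu) <> (xi, h, eta) ->
      Lmin mu xi = set0 /\ Lmin nu eta = set0]].

Definition smul E F : set triple :=
  [set t | exists mu g nu xi h eta a b,
    [/\ E (mu, g, nu), F (xi, h, eta), Lmin nu xi (a, b) &
        t = (comp mu (act S g a),
             (cocycle S g a * cocycle S h (act S h^-1 b))%g,
             comp eta (act S h^-1 b))]].

Definition idempotents : set (set triple) :=
  [set E | SGL E /\ smul E E = E].

Definition in_domain F y := exists mu g nu, F (mu, g, nu) /\ cylinder nu y.

Definition theta F y : infpath L :=
  xget y [set z | exists mu g nu x,
    [/\ F (mu, g, nu), src nu = inf_rge x, y = concat nu x &
        z = concat mu (inf_act S g x)]].

Definition germ_rel F y F' y' :=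
  y = y' /\
  exists E, [/\ idempotents E,
                exists l, E (l, 1%g, l) /\ cylinder l y &
                smul F E = smul F' E].

(* The germ [F, y] is the equivalence class of [(F, y)]. *)
Definition germ F y : set (set triple * infpath L) :=
  [set p | [/\ SGL p.1, in_domain p.1 p.2 & germ_rel F y p.1 p.2]].

Definition is_germ (c : set (set triple * infpath L)) :=
  exists F y, [/\ SGL F, in_domain F y & c = germ F y].

Definition Gtight : Type := {c | is_germ c}.

HB.instance Definition _ := gen_eqMixin Gtight.
HB.instance Definition _ := gen_choiceMixin Gtight.

(* Source and range are computed on a chosen representative; they do not depend
   on it. *)
Lemma Gtight_rep (a : Gtight) : {p : set triple * infpath L |
  [/\ SGL p.1, in_domain p.1 p.2 & sval a = germ p.1 p.2]}.
Proof. by apply: cid; case: (svalP a) => F [y ?]; exists (F, y). Qed.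

Definition tight_src (a : Gtight) : infpath L := (sval (Gtight_rep a)).2.

Definition tight_rge (a : Gtight) : infpath L :=
  theta (sval (Gtight_rep a)).1 (sval (Gtight_rep a)).2.

(* The graph of the product: [tight_prod a b c] means that a b is defined and
   equal to c. *)
Definition tight_prod (a b c : Gtight) : Prop :=
  exists F' F y, [/\ SGL F' /\ in_domain F' (theta F y),
                     SGL F /\ in_domain F y,
                     sval a = germ F' (theta F y),
                     sval b = germ F y &
                     sval c = germ (smul F' F) y].

Definition tight_basic F (nu : L) : set Gtight :=
  [set a | exists2 x, src nu = inf_rge x & sval a = germ F (concat nu x)].

HB.instance Definition _ := @isSubBaseTopological.Build Gtight (set Gtight)
  [set U | exists F mu g nu, [/\ SGL F, F (mu, g, nu) & U = tight_basic F nu]]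
  id.

End Semigroup.

Section GermsAtInfinity.
Variables (k : nat) (G : groupType).

Definition CNG : Type := Nk k -> G.

HB.instance Definition _ := Choice.on CNG.

Implicit Types f h : CNG.

Definition ev_eq f h : bool :=
  `[< exists n0 : Nk k, forall n, leN n0 n -> f n = h n >].

Lemma ev_eq_refl : reflexive ev_eq.
Proof. by move=> f; apply/asboolP; exists 0%R. Qed.

Lemma ev_eq_sym : symmetric ev_eq.
Proof.
by move=> f h; apply/asboolP/asboolP=> -[n0 H]; exists n0 => n /H ->.
Qed.

Lemma leN_joinl (m n p : Nk k) : leN (joinN m n) p -> leN m p.
Proof.
move=> /forallP H; apply/forallP => i; move: (H i); rewrite ffunE geq_max.
by case/andP.
Qed.

Lemma leN_joinr (m n p : Nk k) : leN (joinN m n) p -> leN n p.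
Proof.
move=> /forallP H; apply/forallP => i; move: (H i); rewrite ffunE geq_max.
by case/andP.
Qed.

Lemma ev_eq_trans : transitive ev_eq.
Proof.
move=> h f u /asboolP[m Hm] /asboolP[n Hn]; apply/asboolP.
exists (joinN m n) => p Hp.
by rewrite Hm ?Hn ?(leN_joinl Hp) ?(leN_joinr Hp).
Qed.

Canonical ev_equiv := EquivRel ev_eq ev_eq_refl ev_eq_sym ev_eq_trans.

Definition QNG : Type := {eq_quot ev_equiv}.
HB.instance Definition _ := EqQuotient.on QNG.
HB.instance Definition _ := Choice.on QNG.

Lemma QNG_eqP f h :
  \pi_QNG f = \pi_QNG h <-> exists n0 : Nk k, forall n, leN n0 n -> f n = h n.
Proof. by split=> [/eqmodP/asboolP|H]; [|apply/eqmodP/asboolP]. Qed.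

Definition Qone : QNG := \pi_QNG (fun=> 1%g).
Definition Qmul (a b : QNG) : QNG := \pi_QNG (fun n => repr a n * repr b n)%g.
Definition Qinv (a : QNG) : QNG := \pi_QNG (fun n => (repr a n)^-1)%g.

Lemma repr_pi f : exists n0 : Nk k, forall n, leN n0 n -> repr (\pi_QNG f) n = f n.
Proof. by apply/QNG_eqP; rewrite reprK. Qed.

Lemma Qmul_pi f h :
  Qmul (\pi_QNG f) (\pi_QNG h) = \pi_QNG (fun n => f n * h n)%g.
Proof.
have [m Hm] := repr_pi f; have [n Hn] := repr_pi h.
apply/QNG_eqP; exists (joinN m n) => p Hp.
by rewrite (Hm _ (leN_joinl Hp)) (Hn _ (leN_joinr Hp)).
Qed.

Lemma Qinv_pi f : Qinv (\pi_QNG f) = \pi_QNG (fun n => (f n)^-1)%g.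
Proof.
have [m Hm] := repr_pi f.
by apply/QNG_eqP; exists m => p Hp; rewrite (Hm _ Hp).
Qed.

Lemma QmulA : associative Qmul.
Proof.
elim/quotW=> f; elim/quotW=> h; elim/quotW=> u.
rewrite (Qmul_pi h u) (Qmul_pi f h) (Qmul_pi f (fun n => h n * u n)%g).
rewrite (Qmul_pi (fun n => f n * h n)%g u).
by apply/QNG_eqP; exists 0%R => n _; rewrite mulgA.
Qed.

Lemma Q_mul1g : left_id Qone Qmul.
Proof.
elim/quotW=> f; rewrite Qmul_pi.
by apply/QNG_eqP; exists 0%R => n _; rewrite mul1g.
Qed.

Lemma Q_mulg1 : right_id Qone Qmul.
Proof.
elim/quotW=> f; rewrite Qmul_pi.
by apply/QNG_eqP; exists 0%R => n _; rewrite mulg1.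
Qed.

Lemma Q_mulVg : left_inverse Qone Qinv Qmul.
Proof.
elim/quotW=> f; rewrite Qinv_pi Qmul_pi.
by apply/QNG_eqP; exists 0%R => n _; rewrite mulVg.
Qed.

Lemma Q_mulgV : right_inverse Qone Qinv Qmul.
Proof.
elim/quotW=> f; rewrite Qinv_pi Qmul_pi.
by apply/QNG_eqP; exists 0%R => n _; rewrite mulgV.
Qed.

HB.instance Definition _ := isGroup.Build QNG QmulA Q_mul1g Q_mulg1 Q_mulVg Q_mulgV.

Definition translate (z : Zk k) (f : CNG) : CNG := fun n =>
  if [forall i, (0 <= (toZ n - z)%R i)%R]
  then f [ffun i => absz ((toZ n - z)%R i)] else 1%g.

Definition Qtranslate (z : Zk k) (a : QNG) : QNG :=
  \pi_QNG (translate z (repr a)).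

Definition bound (z : Zk k) (m : Nk k) : Nk k :=
  [ffun i => (m i + absz (z i))%N].

Lemma boundP z m n : leN (bound z m) n ->
  [forall i, (0 <= (toZ n - z)%R i)%R] /\
  leN m [ffun i => absz ((toZ n - z)%R i)].
Proof.
move=> /forallP H.
have K i : ((Posz (m i)) <= (toZ n - z)%R i)%R.
  rewrite !ffunE lerBrDr; apply: (@le_trans _ _ (Posz (m i + absz (z i)))).
    by rewrite PoszD lerD2l abszE ler_norm.
  by rewrite lez_nat; have := H i; rewrite ffunE.
split; apply/forallP => i; first exact: le_trans (K i).
rewrite ffunE -lez_nat; apply: (le_trans (K i)).
by rewrite abszE ler_norm.
Qed.

Lemma Qtranslate_pi z f : Qtranslate z (\pi_QNG f) = \pi_QNG (translate z f).
Proof.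
have [m Hm] := repr_pi f.
apply/QNG_eqP; exists (bound z m) => n /boundP[pos le_m].
by rewrite /translate pos Hm.
Qed.

Lemma QtranslateM z : {morph Qtranslate z : a b / (a * b)%g}.
Proof.
elim/quotW=> f; elim/quotW=> h.
rewrite [LHS](congr1 _ (Qmul_pi f h)) !Qtranslate_pi [RHS]Qmul_pi.
apply/QNG_eqP; exists 0%R => n _; rewrite /translate.
by case: ifP; rewrite ?mulg1.
Qed.

Lemma Qtranslate0 a : Qtranslate 0%R a = a.
Proof.
elim/quotW: a => f; rewrite Qtranslate_pi; apply/QNG_eqP.
exists 0%R => n _; rewrite /translate subr0; case: forallP => [_|[]]; last first.
  by move=> i; rewrite ffunE.
by congr f; apply/ffunP => i; rewrite !ffunE.
Qed.

Lemma QtranslateD (z w : Zk k) (a : QNG) :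
  Qtranslate (z + w)%R a = Qtranslate z (Qtranslate w a).
Proof.
elim/quotW: a => f.
rewrite (Qtranslate_pi w f) (Qtranslate_pi z (translate w f)) Qtranslate_pi.
apply/QNG_eqP; exists (joinN (bound z (bound w 0%R)) (bound (z + w)%R 0%R)) => n Hn.
have [p1 l1] := boundP (leN_joinl Hn); have [p2 _] := boundP l1.
have [p3 _] := boundP (leN_joinr Hn).
have E : (toZ [ffun i => absz ((toZ n - z)%R i)] = toZ n - z :> Zk k)%R.
  apply/ffunP => i; rewrite ffunE ffunE gez0_abs //.
  exact: (forallP p1).
by rewrite /translate p3 p1 p2 E opprD addrA.
Qed.

Record semidirect := Semidirect { qpart : QNG; zpart : Zk k }.

Definition semidirect_pair (a : semidirect) : QNG * Zk k := (qpart a, zpart a).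

Lemma semidirect_pairK :
  cancel semidirect_pair (fun p => Semidirect p.1 p.2).
Proof. by case. Qed.

HB.instance Definition _ := Choice.copy semidirect (can_type semidirect_pairK).

Definition sd_one := Semidirect 1%g 0%R.
Definition sd_mul a b :=
  Semidirect (qpart a * Qtranslate (zpart a) (qpart b))%g
             (zpart a + zpart b)%R.
Definition sd_inv a :=
  Semidirect (Qtranslate (- zpart a)%R (qpart a)^-1%g) (- zpart a)%R.

Lemma sd_mulA : associative sd_mul.
Proof.
move=> [q z] [q' z'] [q'' z'']; congr Semidirect; last exact: addrA.
by rewrite /= QtranslateM -QtranslateD mulgA.
Qed.

Lemma Qtranslate1 z : Qtranslate z 1%g = 1%g.
Proof. by apply: (mulgI (Qtranslate z 1%g)); rewrite -QtranslateM !mulg1. Qed.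

Lemma sd_mul1g : left_id sd_one sd_mul.
Proof.
by move=> [q z]; rewrite /sd_mul /= Qtranslate0 mul1g add0r.
Qed.

Lemma sd_mulg1 : right_id sd_one sd_mul.
Proof.
by move=> [q z]; rewrite /sd_mul /= Qtranslate1 mulg1 addr0.
Qed.

Lemma sd_mulVg : left_inverse sd_one sd_inv sd_mul.
Proof.
move=> [q z]; rewrite /sd_mul /sd_inv /= addNr -QtranslateM.
by rewrite mulVg Qtranslate1.
Qed.

Lemma sd_mulgV : right_inverse sd_one sd_inv sd_mul.
Proof.
move=> [q z]; rewrite /sd_mul /sd_inv /= addrN -QtranslateD addrN.
by rewrite Qtranslate0 mulgV.
Qed.

HB.instance Definition _ :=
  isGroup.Build semidirect sd_mulA sd_mul1g sd_mulg1 sd_mulVg sd_mulgV.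

End GermsAtInfinity.

Section PathGroupoid.
Variables (k : nat) (G : groupType) (L : kgraph k) (S : selfsimilar G L).

(* The elements (x; q; y) of the product groupoid. *)
Definition ambient : Type := (infpath L * semidirect k G * infpath L)%type.

Definition inf_cocycle (g : G) (x : infpath L) : CNG k G :=
  fun n => cocycle S g (x 0%R n).

Definition elementGGL (mu : L) (g : G) (nu : L) (x : infpath L) : ambient :=
  (concat mu (inf_act S g x),
   Semidirect (Qtranslate (toZ (deg mu)) (\pi_(QNG k G) (inf_cocycle g x)))
              (toZ (deg mu) - toZ (deg nu))%R,
   concat nu x).

Definition inGGL (a : ambient) := exists g mu nu x,
  [/\ src mu = act S g (src nu), src nu = inf_rge x & a = elementGGL mu g nu x].

Definition GGL : Type := {a | inGGL a}.

HB.instance Definition _ := gen_eqMixin GGL.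
HB.instance Definition _ := gen_choiceMixin GGL.

Definition GGL_rge (a : GGL) : infpath L := (sval a).1.1.
Definition GGL_src (a : GGL) : infpath L := (sval a).2.

(* The graph of the product, as for [tight_prod]. *)
Definition GGL_prod (a b c : GGL) : Prop :=
  GGL_src a = GGL_rge b /\
  sval c = (GGL_rge a, ((sval a).1.2 * (sval b).1.2)%g, GGL_src b).

Definition GGL_basic (mu : L) (g : G) (nu : L) : set GGL :=
  [set a | exists2 x, src nu = inf_rge x & sval a = elementGGL mu g nu x].

HB.instance Definition _ := @isSubBaseTopological.Build GGL (set GGL)
  [set U | exists mu g nu,
    src mu = act S g (src nu) /\ U = GGL_basic mu g nu] id.

End PathGroupoid.

(* Main.v *)
(* Two triples [(mu, g, nu)], [(mu', g', nu')] whose cylinders contain the same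
   infinite path can be extended along it to [(mu (g a), phi(g, a), nu a)] and
   [(mu' (g' a'), phi(g', a'), nu' a')] with [nu a = nu' a'], and extending a
   triple changes neither the germ nor the element of the path groupoid that it
   defines. Multiplying by an idempotent {(l, 1, l)} with [l] long enough
   performs exactly such an extension, so two germs agree iff the corresponding
   elements (x; q; y) agree: equality of the Q-parts means that the cocycles
   agree far out along the path, where one extends once more. Hence psi is well
   defined and bijective. It matches the basic open sets of both topologies, and
   extending composable elements until the inner paths coincide reduces the
   product to (mu, g, nu)(nu, h, eta) = (mu, gh, eta). *)
Require Import Defs.
From mathcomp Require Import all_boot all_order all_algebra.
From mathcomp Require Import boolp classical_sets functions cardinality.
From mathcomp Require Import filter topology.

Local Open Scope classical_set_scope.

Set Implicit Arguments.
Unset Strict Implicit.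
Unset Printing Implicit Defensive.

Import GRing.Theory.

(* [ssrfun] shadowed [comp] and [compA]. *)
Import Defs.

(** * Multidegrees: order, joins and cancellation *)

Section Multidegree.
Variable k : nat.
Implicit Types m n p : Nk k.

Lemma leN_addr m n : leN m (m + n)%R.
Proof. by apply/forallP => i; rewrite ffunE leq_addr. Qed.

Lemma leNE m n : leN m n -> exists p, n = (m + p)%R.
Proof.
move=> /forallP H; exists [ffun i => (n i - m i)%N].
by apply/ffunP => i; rewrite !ffunE -[RHS]/(m i + (n i - m i))%N subnKC.
Qed.

Lemma leN_refl m : leN m m.
Proof. by apply/forallP. Qed.

Lemma addNI m : injective (fun n => (m + n)%R).
Proof.
by move=> n p /ffunP H; apply/ffunP => i; have := H i; rewrite !ffunE => /addnI.
Qed.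

Lemma leN_join m n p : leN m p -> leN n p -> leN (joinN m n) p.
Proof.
move=> /forallP H /forallP H'; apply/forallP => i.
by rewrite ffunE geq_max H H'.
Qed.

Lemma joinN_addr m n : joinN m (m + n)%R = (m + n)%R.
Proof. by apply/ffunP => i; rewrite !ffunE; apply/maxn_idPr/leq_addr. Qed.

Lemma toZD m n : toZ (m + n)%R = (toZ m + toZ n)%R.
Proof. by apply/ffunP => i; rewrite !ffunE PoszD. Qed.

Lemma toZ_inj : injective (@toZ k).
Proof.
by move=> m n /ffunP H; apply/ffunP => i; have := H i; rewrite !ffunE => -[].
Qed.

End Multidegree.

(** * Finite paths: unique factorisation, prefixes and minimal common extensions *)

Section Paths.
Variables (k : nat) (L : kgraph k).
Implicit Types (a b c l p w : L) (m n : Nk k).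

Lemma comp_inj a b a' b' : src a = rge b -> src a' = rge b' ->
  deg a = deg a' -> comp a b = comp a' b' -> a = a' /\ b = b'.
Proof.
move=> ab ab' da e.
have db : deg b = deg b'.
  by apply: (@addNI _ (deg a)); rewrite -deg_comp// e deg_comp// da.
have [q [_ uq]] := factorisation (deg_comp ab).
have := uq (a, b); have := uq (a', b') => /=.
rewrite da db e => h1 h2.
by have [-> ->] : (a, b) = (a', b') by rewrite -h1// -h2.
Qed.

Lemma comp_injr a b b' : src a = rge b -> src a = rge b' ->
  comp a b = comp a b' -> b = b'.
Proof. by move=> h h' /(comp_inj h h' erefl)[]. Qed.

(** Here [comp (rge l) l] and [comp l (src l)] are two factorisations of [l] into factors of degree
    0, so unique factorisation identifies them. *)
Lemma deg0_src l : deg l = 0%R -> src l = l.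
Proof.
move=> dl; have [e _] : rge l = l /\ l = src l; last first.
  by rewrite -e src_rge.
apply: comp_inj; rewrite ?src_rge ?rge_src ?deg_rge//.
by rewrite comp_rge comp_src.
Qed.

Lemma comp_deg0 a b : src a = rge b -> deg b = 0%R -> comp a b = a.
Proof.
move=> ab b0.
by rewrite -(deg0_src b0) -rge_src (deg0_src b0) -ab comp_src.
Qed.

Definition prefix a b := exists2 c, src a = rge c & b = comp a c.

Lemma prefix_refl a : prefix a a.
Proof. by exists (src a); rewrite ?rge_src ?comp_src. Qed.

Lemma prefix_trans a b c : prefix a b -> prefix b c -> prefix a c.
Proof.
move=> [u au ->] [v]; rewrite src_comp// => uv ->.
by exists (comp u v); rewrite ?rge_comp// compA.
Qed.

Lemma prefix_exists n w : leN n (deg w) -> exists2 a, prefix a w & deg a = n.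
Proof.
move=> /leNE[m /factorisation[[a b] [[/= da _ ab e] _]]].
by exists a => //; exists b.
Qed.

Lemma prefix_uniq a b w : prefix a w -> prefix b w -> deg a = deg b -> a = b.
Proof. by move=> [u au ->] [v bv e] d; have [] := comp_inj au bv d e. Qed.

Lemma prefix_deg a b : prefix a b -> leN (deg a) (deg b).
Proof. by move=> [c ac ->]; rewrite deg_comp// leN_addr. Qed.

(** Cutting [b] at the degree of [a] gives a prefix of [w] of that degree, and there is only one. *)
Lemma prefix_linear a b w :
  prefix a w -> prefix b w -> leN (deg a) (deg b) -> prefix a b.
Proof.
move=> aw bw /prefix_exists[a' a'b da'].
by rewrite (prefix_uniq aw (prefix_trans a'b bw)).
Qed.

(** A common extension of any degree can be cut down to the join of the two degrees. This is how the
    disjointness condition of [SGL] gets contradicted. *)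
Lemma Lmin_exists a b w : prefix a w -> prefix b w -> Lmin a b !=set0.
Proof.
move=> aw bw; have := leN_join (prefix_deg aw) (prefix_deg bw).
move=> /prefix_exists[p pw dp].
have [u au e] : prefix a p.
  by apply: prefix_linear aw pw _; rewrite dp; apply: leN_joinl (leN_refl _).
have [v bv e'] : prefix b p.
  by apply: prefix_linear bw pw _; rewrite dp; apply: leN_joinr (leN_refl _).
by exists (u, v); split => //=; rewrite -e.
Qed.

(** The join of the two degrees is that of [comp a b], so the second extension has degree 0; left
    cancellation then determines the first. *)
Lemma Lmin_comp a b : src a = rge b ->
  Lmin a (comp a b) = [set (b, src (comp a b))].
Proof.
move=> ab; apply/seteqP; split => [[u v] [/= au abv e d]|_ ->]; last first.
  split => /=; rewrite ?rge_src ?comp_src//.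
  by rewrite deg_comp// joinN_addr.
have v0 : src v = v.
  apply: deg0_src; apply: (@addNI _ (deg (comp a b))).
  by rewrite -deg_comp// -e d deg_comp// joinN_addr addr0.
move: e; rewrite -v0 -[in src v]v0 src_src v0 => e.
have ev : v = src (comp a b) by rewrite abv -v0 rge_src.
by move: e; rewrite ev comp_src => /(comp_injr au ab) ->.
Qed.

End Paths.

(** * Infinite paths: initial segments, concatenation and shifts *)

Section InfinitePaths.
Variables (k : nat) (L : kgraph k).
Implicit Types (a b l : L) (x y z : infpath L) (m n : Nk k).

Lemma prefix_infpath x m n : prefix (x 0%R m) (x 0%R (m + n)%R).
Proof.
exists (x m n); last by rewrite comp_segment add0r.
by rewrite src_segment add0r rge_segment.
Qed.

(** The segment x(p, p + n) is recovered from x(0, p) and x(0, p + n) by left cancellation. *)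
Lemma infpath_eq x y : (forall n, x 0%R n = y 0%R n) -> x = y.
Proof.
move=> e; have {e} : segment x = segment y.
  apply/funext => p; apply/funext => n.
  have := comp_segment x 0%R p n; rewrite e comp_segment e !add0r => h.
  have sx : src (x 0%R p) = rge (x p n).
    by rewrite src_segment rge_segment add0r.
  apply: (comp_injr _ _ (esym h)); first by rewrite -e.
  by rewrite src_segment rge_segment add0r.
case: x y => [x x1 x2 x3 x4] [y y1 y2 y3 y4] /= e.
by subst y; congr InfPath; exact: Prop_irrelevance.
Qed.

Lemma infpath_cofinal_eq m x y :
  (forall n, x 0%R (m + n)%R = y 0%R (m + n)%R) -> x = y.
Proof.
move=> e; apply: infpath_eq => n.
apply: (@prefix_uniq _ _ _ _ (x 0%R (m + n)%R)); rewrite ?deg_segment//.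
  by rewrite addrC; exact: prefix_infpath.
by rewrite e addrC; exact: prefix_infpath.
Qed.

(** The segment from p to p + n has to be the factor that completes [w p] to [w (p + n)];
    functoriality follows by cancelling [w p]. *)
Lemma infpath_exists (w : Nk k -> L) : (forall n, deg (w n) = n) ->
  (forall m n, prefix (w m) (w (m + n)%R)) ->
  exists y : infpath L, forall n, y 0%R n = w n.
Proof.
move=> dw pw.
have /choice[f fP] : forall mn : Nk k * Nk k, exists c,
    src (w mn.1) = rge c /\ w (mn.1 + mn.2)%R = comp (w mn.1) c.
  by move=> [m n]; have [c h1 h2] := pw m n; exists c.
pose s p n := f (p, n).
have sr p n : src (w p) = rge (s p n) by have [] := fP (p, n).
have sw p n : w (p + n)%R = comp (w p) (s p n) by have [] := fP (p, n).
have s0 p : s p 0%R = src (w p).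
  apply: (@comp_injr _ _ (w p)); rewrite ?rge_src//.
  by rewrite -sw addr0 comp_src.
have h1 p n : deg (s p n) = n.
  by apply: (@addNI _ p); rewrite -{1}[p]dw -deg_comp// -sw dw.
have h2 p n : rge (s p n) = s p 0%R by rewrite -sr s0.
have h3 p n : src (s p n) = s (p + n)%R 0%R.
  by rewrite s0 sw src_comp.
have h4 p m n : s p (m + n)%R = comp (s p m) (s (p + m)%R n).
  have e : src (s p m) = rge (s (p + m)%R n) by rewrite h3 h2.
  apply: (@comp_injr _ _ (w p)); rewrite ?rge_comp//.
  by rewrite compA// -!sw addrA.
exists (InfPath h1 h2 h3 h4) => n /=.
have w0 : src (w 0%R) = w 0%R by apply: deg0_src; rewrite dw.
by rewrite -{2}[n]add0r sw -[in RHS]w0 (sr 0%R n) comp_rge.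
Qed.

Lemma src_infpath0 x n : src (x 0%R n) = x n 0%R.
Proof. by rewrite src_segment add0r. Qed.

(** Since [concat] is given by [xget], a path with its defining property has to be constructed
    first. *)
Lemma concatE l x n : src l = inf_rge x ->
  concat l x 0%R (deg l + n)%R = comp l (x 0%R n).
Proof.
move=> lx.
have cx j : src l = rge (x 0%R j) by rewrite rge_segment.
(* The path [comp l (x 0 j)] has degree [deg l + j], which is at least j, so it can be cut at degree
   j. These cuts are the initial segments of the concatenation. *)
have /choice[w wP] : forall j, exists a,
    prefix a (comp l (x 0%R j)) /\ deg a = j.
  move=> j; have [|a ? ?] := @prefix_exists _ _ j (comp l (x 0%R j)).
    by rewrite deg_comp// deg_segment addrC leN_addr.
  by exists a.
have lpre i j : prefix (comp l (x 0%R i)) (comp l (x 0%R (i + j)%R)).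
  have [c h e] := prefix_infpath x i j; exists c; first by rewrite src_comp.
  by rewrite e compA.
have [||y yw] := @infpath_exists w.
- by move=> j; have [] := wP j.
- move=> i j; have [pi di] := wP i; have [pj dj] := wP (i + j)%R.
  apply: prefix_linear (prefix_trans pi (lpre i j)) pj _.
  by rewrite di dj leN_addr.
have yl j : y 0%R (deg l + j)%R = comp l (x 0%R j).
  rewrite yw; have [p d] := wP (deg l + j)%R.
  apply: prefix_uniq p _ _; first by rewrite addrC; exact: lpre.
  by rewrite d deg_comp// deg_segment.
have x0 : x 0%R 0%R = src l by [].
have hy : [set y : infpath L | y 0%R (deg l) = l /\
    forall p n, y (deg l + p)%R n = x p n] y.
  split; first by rewrite -[deg l]addr0 yl x0 comp_src.
  move=> p j; apply: (@comp_injr _ _ (y 0%R (deg l + p)%R)).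
  - by rewrite src_infpath0 rge_segment.
  - by rewrite yl src_comp// src_infpath0 rge_segment.
  - have := comp_segment y 0%R (deg l + p)%R j; rewrite add0r => <-.
    rewrite -addrA !yl comp_segment add0r compA//.
    by rewrite src_infpath0 rge_segment.
have [h1 h2] := xgetI x hy.
have := comp_segment (concat l x) 0%R (deg l) n.
rewrite add0r => ->; congr comp; first exact: h1.
by rewrite -(h2 0%R n) addr0.
Qed.

Lemma concat_prefix l x : src l = inf_rge x -> concat l x 0%R (deg l) = l.
Proof.
move=> h; have := @concatE l x 0%R h; rewrite addr0 => ->.
by rewrite -/(inf_rge x) -h comp_src.
Qed.

Lemma concat_eq l x y : src l = inf_rge x ->
  (forall n, y 0%R (deg l + n)%R = comp l (x 0%R n)) -> concat l x = y.
Proof.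
by move=> h e; apply: (@infpath_cofinal_eq (deg l)) => n; rewrite e concatE.
Qed.

Lemma inf_rge_concat l x : src l = inf_rge x -> inf_rge (concat l x) = rge l.
Proof.
by move=> h; rewrite /inf_rge -(rge_segment _ _ (deg l)) concat_prefix.
Qed.

Lemma concat_comp a b x : src a = rge b -> src b = inf_rge x ->
  concat (comp a b) x = concat a (concat b x).
Proof.
move=> ab bx; apply: concat_eq; first by rewrite src_comp.
move=> n; rewrite deg_comp// -addrA concatE ?inf_rge_concat// concatE// compA//.
by rewrite rge_segment.
Qed.

Lemma concat_inj a b x y : src a = inf_rge x -> src b = inf_rge y ->
  deg a = deg b -> concat a x = concat b y -> a = b /\ x = y.
Proof.
move=> ax bY d e.
have eab : a = b by rewrite -(concat_prefix ax) -(concat_prefix bY) e d.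
split => //; apply: infpath_eq => n; apply: (@comp_injr _ _ a).
- by rewrite rge_segment.
- by rewrite rge_segment eab.
- by rewrite -concatE// e [in RHS]eab -concatE// d.
Qed.

Lemma concat_injr a x y : src a = inf_rge x -> src a = inf_rge y ->
  concat a x = concat a y -> x = y.
Proof. by move=> h h' /(concat_inj h h' erefl)[]. Qed.

Lemma infpath_split x n : exists2 y,
  src (x 0%R n) = inf_rge y & x = concat (x 0%R n) y.
Proof.
pose s p m := x (n + p)%R m.
have h1 p m : deg (s p m) = m by rewrite deg_segment.
have h2 p m : rge (s p m) = s p 0%R by rewrite /s rge_segment.
have h3 p m : src (s p m) = s (p + m)%R 0%R by rewrite /s src_segment addrA.
have h4 p m j : s p (m + j)%R = comp (s p m) (s (p + m)%R j).
  by rewrite /s comp_segment addrA.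
have h : src (x 0%R n) = inf_rge (InfPath h1 h2 h3 h4).
  by rewrite /inf_rge /= /s src_infpath0 addr0.
exists (InfPath h1 h2 h3 h4) => //.
apply/esym/concat_eq => // m; rewrite deg_segment comp_segment /= /s.
by rewrite add0r addr0.
Qed.

(** Cut the common infinite path at the join of the two degrees: the completions of [a] and [b] up
    to the cut form the pair in [Lmin], and what follows the cut is the shared tail [z]. *)
Lemma concat_common a b x y : src a = inf_rge x -> src b = inf_rge y ->
  concat a x = concat b y -> exists u v z,
  [/\ Lmin a b (u, v), src u = inf_rge z, src v = inf_rge z,
      x = concat u z & y = concat v z].
Proof.
move=> ax bY e; set t := concat a x.
pose p := t 0%R (joinN (deg a) (deg b)).
have dp : deg p = joinN (deg a) (deg b) by rewrite deg_segment.
have [u au eu] : prefix a p.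
  have [c cE] := leNE (leN_joinl (leN_refl (joinN (deg a) (deg b)))).
  by rewrite /p cE -[a in prefix a _](concat_prefix ax); exact: prefix_infpath.
have [v bv ev] : prefix b p.
  have [c cE] := leNE (leN_joinr (leN_refl (joinN (deg a) (deg b)))).
  rewrite /p cE /t e -[b in prefix b _](concat_prefix bY).
  exact: prefix_infpath.
have [z pz tz] : exists2 z, src p = inf_rge z & t = concat p z.
  exact: infpath_split.
have uz : src u = inf_rge z by rewrite -pz eu src_comp.
have vz : src v = inf_rge z by rewrite -pz ev src_comp.
exists u, v, z; split => //.
- by split => //=; rewrite -eu.
- apply: (@concat_injr a) => //; first by rewrite inf_rge_concat.
  by rewrite -concat_comp// -eu.
- apply: (@concat_injr b) => //; first by rewrite inf_rge_concat.
  by rewrite -concat_comp// -ev -e.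
Qed.

End InfinitePaths.

(** * The action of the group on finite and infinite paths *)

Section SelfSimilarAction.
Variables (k : nat) (G : groupType) (L : kgraph k) (S : selfsimilar G L).
Implicit Types (a b l mu nu xi eta u v : L) (g h : G) (x y z : infpath L).

Lemma cocycle1 l : cocycle S 1%g l = 1%g.
Proof.
have := cocycleM S 1%g 1%g l; rewrite mulg1 act1 => e.
by apply: (mulgI (cocycle S 1%g l)); rewrite -e mulg1.
Qed.

Lemma actK g l : act S g^-1%g (act S g l) = l.
Proof. by rewrite -actM mulVg act1. Qed.

Lemma actVK g l : act S g (act S g^-1%g l) = l.
Proof. by rewrite -actM mulgV act1. Qed.

Lemma cocycle_deg0 g a : deg a = 0%R -> cocycle S g a = g.
Proof. exact: cocycle_vertex. Qed.

(** This is the composability half of [act_comp], for [l] followed by its source. Together with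
    [src_act] it says that [g] and [cocycle S g l] agree on that vertex. *)
Lemma src_act_cocycle g l : src (act S g l) = act S (cocycle S g l) (src l).
Proof.
have [|-> _] := @act_comp _ _ _ S g l (src l); first by rewrite rge_src.
by rewrite rge_act rge_src.
Qed.

Lemma inf_actE g x n : inf_act S g x 0%R n = act S g (x 0%R n).
Proof.
have [||y yE] := @infpath_exists _ L (fun n => act S g (x 0%R n)).
- by move=> m; rewrite deg_act deg_segment.
- move=> m j; have [c xc ->] := prefix_infpath x m j.
  have [h ->] := @act_comp _ _ _ S g _ _ xc.
  by exists (act S (cocycle S g (x 0%R m)) c).
rewrite /inf_act; set P := (X in xget _ X).
exact: (@xgetI _ x P y yE).
Qed.

Lemma inf_rge_act g x : inf_rge (inf_act S g x) = act S g (inf_rge x).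
Proof. exact: inf_actE. Qed.

Lemma inf_actM g h x : inf_act S (g * h)%g x = inf_act S g (inf_act S h x).
Proof. by apply: infpath_eq => n; rewrite !inf_actE actM. Qed.

Lemma inf_act1 x : inf_act S 1%g x = x.
Proof. by apply: infpath_eq => n; rewrite inf_actE act1. Qed.

Lemma src_act_inf_rge g l x : src l = inf_rge x ->
  src (act S g l) = inf_rge (inf_act S (cocycle S g l) x).
Proof. by move=> lx; rewrite src_act_cocycle lx inf_rge_act. Qed.

Lemma inf_act_concat g l x : src l = inf_rge x ->
  inf_act S g (concat l x) = concat (act S g l) (inf_act S (cocycle S g l) x).
Proof.
move=> lx; apply/esym/concat_eq; first exact: src_act_inf_rge.
move=> n; rewrite deg_act inf_actE concatE// inf_actE.
by have [|_ ->//] := @act_comp _ _ _ S g l (x 0%R n); rewrite rge_segment.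
Qed.

(** * Elements of the path groupoid under extension and multiplication *)

Lemma Qtranslate_inj (z : Zk k) : injective (@Qtranslate k G z).
Proof.
apply: (can_inj (g := Qtranslate (- z)%R)) => q.
by rewrite -QtranslateD addNr Qtranslate0.
Qed.

Lemma translateD (m n : Nk k) (f : CNG k G) :
  translate (toZ m) f (m + n)%R = f n.
Proof.
have -> : translate (toZ m) f (m + n)%R =
    if [forall i, (0 <= toZ n i)%R] then f [ffun i => absz (toZ n i)] else 1%g.
  by rewrite /translate toZD addrAC subrr add0r.
case: forallP => [_|[]]; last by move=> i; rewrite ffunE.
by congr f; apply/ffunP => i; rewrite !ffunE.
Qed.

Lemma elementGGL_refine mu g nu a x : src mu = act S g (src nu) ->
  src nu = rge a -> src a = inf_rge x ->
  elementGGL S mu g nu (concat a x) =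
  elementGGL S (comp mu (act S g a)) (cocycle S g a) (comp nu a) x.
Proof.
move=> mn na ax; have ma : src mu = rge (act S g a) by rewrite mn na rge_act.
rewrite /elementGGL inf_act_concat// -concat_comp//; last first.
  exact: src_act_inf_rge.
rewrite -(concat_comp na ax).
set d1 := Semidirect _ _; set d2 := Semidirect _ _.
suff -> : d1 = d2 by [].
rewrite {}/d1 {}/d2; congr Semidirect.
- rewrite !Qtranslate_pi; apply/QNG_eqP.
  (* From this degree on, the left translate reads the cocycle of [g] at a segment that begins with
     [a], where [cocycle_comp] turns it into the right one. *)
  exists (deg mu + deg a)%R => n /leNE[p ->].
  rewrite deg_comp// deg_act.
  rewrite translateD -addrA translateD /inf_cocycle concatE//.
  by rewrite cocycle_comp// rge_segment.
- by rewrite !deg_comp// deg_act !toZD opprD addrACA subrr addr0.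
Qed.

(** Because the inner path [nu] is shared, the twist by d(mu) - d(nu) in the semidirect product
    turns the translation by d(nu) into one by d(mu). What remains is the cocycle identity at each
    degree. *)
Lemma elementGGL_mul mu g nu h eta x :
  (concat mu (inf_act S g (inf_act S h x)),
   ((elementGGL S mu g nu (inf_act S h x)).1.2 *
      (elementGGL S nu h eta x).1.2)%g,
   concat eta x) = elementGGL S mu (g * h)%g eta x.
Proof.
rewrite /elementGGL inf_actM; set d := (_ * _)%g; set d' := Semidirect _ _.
suff -> : d = d' by [].
congr Semidirect => /=; last by rewrite addrA subrK.
rewrite -QtranslateD subrK -QtranslateM.
congr Qtranslate; apply: etrans (Qmul_pi _ _) _.
apply/QNG_eqP; exists 0%R => n _.
by rewrite /inf_cocycle inf_actE -cocycleM.
Qed.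

(** Extending by [u] and by [v] makes both inner paths equal to [comp nu u], so [elementGGL_mul]
    applies. The triple on the right is the one that [smul] forms from the pair [(u, act S h v)]. *)
Lemma elementGGL_mul_refine mu g nu xi h eta u v z
    (t := inf_act S (cocycle S h v) z) :
  src mu = act S g (src nu) -> src xi = act S h (src eta) ->
  src nu = rge u -> src eta = rge v -> src u = inf_rge t -> src v = inf_rge z ->
  comp nu u = comp xi (act S h v) ->
  (concat mu (inf_act S g (concat u t)),
   ((elementGGL S mu g nu (concat u t)).1.2 *
      (elementGGL S xi h eta (concat v z)).1.2)%g,
   concat eta (concat v z)) =
  elementGGL S (comp mu (act S g u)) (cocycle S g u * cocycle S h v)%g
    (comp eta v) z.
Proof.
move=> mn xe nu_u eta_v uz vz e; rewrite !elementGGL_refine// e.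
rewrite -(elementGGL_mul _ _ (comp xi (act S h v))) inf_act_concat//.
rewrite [in RHS]concat_comp//; last 2 first.
- by rewrite mn nu_u rge_act.
- exact: src_act_inf_rge.
by rewrite concat_comp.
Qed.

End SelfSimilarAction.

(** * Triples of a semigroup element along a path, idempotents and singletons *)

Section Germs.
Variables (k : nat) (G : groupType) (L : kgraph k) (S : selfsimilar G L).
Implicit Types (a b l mu nu xi eta u v : L) (g h : G) (x y z : infpath L).
Implicit Types (E F : set (triple G L)).

(** Third parts with a common extension have nonempty [Lmin], which distinct triples of [F]
    exclude. *)
Lemma SGL_uniq_prefix F mu g nu mu' g' nu' w : SGL S F ->
  F (mu, g, nu) -> F (mu', g', nu') -> prefix nu w -> prefix nu' w ->
  [/\ mu = mu', g = g' & nu = nu'].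
Proof.
move=> [_ _ SF] Fn Fn' nw n'w.
have [[-> -> ->]|/(SF _ _ _ _ _ _ Fn Fn')[_ e]] :=
  EM ((mu, g, nu) = (mu', g', nu')); first by [].
by have := Lmin_exists nw n'w; rewrite e => -[].
Qed.

Lemma SGL_src F mu g nu : SGL S F -> F (mu, g, nu) -> src mu = act S g (src nu).
Proof. by case=> _ + _; apply. Qed.

Lemma SGL_set1 mu g nu : src mu = act S g (src nu) -> SGL S [set (mu, g, nu)].
Proof.
move=> e; split; first exact: finite_set1.
  by move=> _ _ _ [-> -> ->].
by move=> ? ? ? ? ? ? -> -> /(_ erefl).
Qed.

Lemma SGL_uniq_concat F mu g nu mu' g' nu' x x' : SGL S F ->
  F (mu, g, nu) -> F (mu', g', nu') ->
  src nu = inf_rge x -> src nu' = inf_rge x' ->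
  concat nu x = concat nu' x' ->
  [/\ mu = mu', g = g', nu = nu' & x = x'].
Proof.
move=> SF Fn Fn' nx n'x' e.
have [u [v [z [[/= nu_u nu'_v uv _] _ _ _ _]]]] := concat_common nx n'x' e.
have [] := @SGL_uniq_prefix F mu g nu mu' g' nu' (comp nu u) SF Fn Fn'.
- by exists u.
- by rewrite uv; exists v.
move=> -> -> en; split => //; apply: (@concat_injr _ _ nu) => //.
  by rewrite en.
by rewrite e en.
Qed.

Lemma thetaE F mu g nu x : SGL S F -> F (mu, g, nu) -> src nu = inf_rge x ->
  theta S F (concat nu x) = concat mu (inf_act S g x).
Proof.
move=> SF Fn nx; rewrite /theta; set P := (X in xget _ X).
have [] := @xgetI _ (concat nu x) P (concat mu (inf_act S g x)).
  by exists mu, g, nu, x; split.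
move=> mu' [g' [nu' [x' [Fn' nx' e ->]]]].
by have [-> -> _ ->] := SGL_uniq_concat SF Fn Fn' nx nx' e.
Qed.

(** Write the triple as a product of two triples of [E]. The first part of the left factor is a
    prefix of [mu] and the third part of the right factor a prefix of [nu], so by disjointness both
    factors are the triple itself. Degrees then force trivial extensions, whence [nu = mu] and
    [g = g * g]. *)
Lemma idempotent_diag E mu g nu : idempotents S E -> E (mu, g, nu) ->
  g = 1%g /\ mu = nu.
Proof.
move=> [SE EE] En; have [_ _ disjE] := SE.
have := En; rewrite -[X in X (mu, g, nu)]EE.
move=> [mu' [g' [nu' [xi [h [eta [u [v [En' Ex + []]]]]]]]]].
move=> [/= nu_u xi_v uv _].
set b := act S h^-1 v => e1 e2 e3.
have en : src eta = rge b.
  have := SGL_src SE Ex; rewrite xi_v => e.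
  by rewrite /b rge_act e actK.
have em : src mu' = rge (act S g' u).
  by rewrite (SGL_src SE En') nu_u rge_act.
have [? ? ?] : [/\ xi = mu, h = g & eta = nu].
  apply: (@SGL_uniq_prefix E _ _ _ _ _ _ nu SE Ex En); last exact: prefix_refl.
  by exists b.
have [? ? ?] : [/\ mu' = mu, g' = g & nu' = nu].
  have [[-> -> ->]|/(disjE _ _ _ _ _ _ En' En)[e _]] :=
    EM ((mu', g', nu') = (mu, g, nu)); first by [].
  have : Lmin mu' mu !=set0.
    apply: (@Lmin_exists _ _ _ _ mu); last exact: prefix_refl.
    by exists (act S g' u).
  by rewrite e => -[].
subst xi h eta mu' g' nu'.
have u0 : deg u = 0%R.
  by apply: (@addNI _ (deg mu)); rewrite addr0 -(deg_act S g u) -deg_comp// -e1.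
have b0 : deg b = 0%R.
  by apply: (@addNI _ (deg nu)); rewrite addr0 -deg_comp// -e3.
have v0 : deg v = 0%R by rewrite -(deg_act S g^-1%g v).
split; last by move: uv; rewrite !comp_deg0.
by apply: (mulgI g); rewrite mulg1 {3}e2 !cocycle_deg0.
Qed.

(** Only [(mu, g, nu)] can contribute, and [Lmin nu (comp nu a)] is a single pair. With [h = 1] and
    [eta = comp nu a], multiplying by an idempotent extends the triple along [a]. *)
Lemma smul_set1r F mu g nu a h eta : SGL S F -> F (mu, g, nu) ->
  src nu = rge a -> src (comp nu a) = act S h (src eta) ->
  smul S F [set (comp nu a, h, eta)] =
  [set (comp mu (act S g a), (cocycle S g a * h)%g, eta)].
Proof.
move=> SF Fn na ah.
have he : act S h^-1%g (src (comp nu a)) = src eta by rewrite ah actK.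
apply/seteqP; split => [t|_ ->].
  move=> [mu' [g' [nu' [_ [_ [_ [u [v [Fn' [-> -> ->] uv]]]]]]]]].
  have [/= n'u av e _] := uv.
  have [em eg en] : [/\ mu' = mu, g' = g & nu' = nu].
    apply: (SGL_uniq_prefix SF Fn' Fn); first by exists u.
    rewrite e; exists (comp a v); first by rewrite rge_comp// -av src_comp.
    by rewrite compA// -av src_comp.
  move: uv; rewrite em eg en Lmin_comp// => -[-> ->].
  by rewrite he comp_src [cocycle S h _]cocycle_deg0// deg_src.
exists mu, g, nu, (comp nu a), h, eta, a, (src (comp nu a)); split => //.
  by rewrite Lmin_comp.
by rewrite he comp_src [cocycle S h _]cocycle_deg0// deg_src.
Qed.

Lemma smul_set1 mu g nu h eta :
  src mu = act S g (src nu) -> src nu = act S h (src eta) ->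
  smul S [set (mu, g, nu)] [set (nu, h, eta)] = [set (mu, (g * h)%g, eta)].
Proof.
move=> mn ne; have := @smul_set1r [set (mu, g, nu)] mu g nu (src nu) h eta.
rewrite rge_src comp_src -mn comp_src cocycle_deg0 ?deg_src// => -> //.
exact: SGL_set1.
Qed.

Lemma idempotents_set1 l : idempotents S [set (l, 1%g, l)].
Proof.
split; first by apply: SGL_set1; rewrite act1.
by rewrite smul_set1 ?act1// mulg1.
Qed.

(** * Equality of germs as equality of elements of the path groupoid *)

Lemma germ_rel_elementGGL F mu g nu x F' mu' g' nu' x' :
  src mu = act S g (src nu) -> F (mu, g, nu) -> SGL S F' -> F' (mu', g', nu') ->
  src nu = inf_rge x -> src nu' = inf_rge x' ->
  germ_rel S F (concat nu x) F' (concat nu' x') ->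
  elementGGL S mu g nu x = elementGGL S mu' g' nu' x'.
Proof.
move=> mn Fn SF' Fn' nx n'x' [exx' [E [idE [l [El [y ly exy]]] FE]]].
have [u [v [z [uv uz vz ex _]]]] := concat_common nx ly exy.
(* The extended triple lies in [smul F E], hence also in [smul F' E]. The triple of [F'] it comes
   from has its third part on the same infinite path, so it is [(mu', g', nu')], and both elements
   refine to the same one. *)
have : smul S F E (comp mu (act S g u), cocycle S g u, comp l v).
  exists mu, g, nu, l, 1%g, l, u, v; split => //.
  by rewrite invg1 act1 cocycle1 mulg1.
rewrite FE => -[mu2 [g2 [nu2 [xi [h [eta [a [b [Fn2 Exi ab]]]]]]]]].
have [-> exi] := idempotent_diag idE Exi; rewrite {}exi {Exi} in ab.
rewrite invg1 act1 cocycle1 mulg1 => -[e1 e2 e3].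
have [/= nu_u l_v eu _] := uv; have [/= n2a eta_b ea _] := ab.
have az : src a = inf_rge z.
  rewrite -uz -(src_comp nu_u) eu e3 -ea.
  by rewrite src_comp.
have e : concat nu2 (concat a z) = concat nu' x'.
  by rewrite -concat_comp// ea -e3 -eu concat_comp// -ex.
have [] := SGL_uniq_concat SF' Fn2 Fn' _ n'x' e.
  by rewrite inf_rge_concat.
move=> <- <- <- <-; rewrite ex elementGGL_refine// elementGGL_refine//.
  by rewrite e1 e2 eu e3 -ea.
exact: (SGL_src SF' Fn2).
Qed.

Lemma elementGGL_germ_rel F mu g nu x F' mu' g' nu' x' :
  SGL S F -> F (mu, g, nu) -> SGL S F' -> F' (mu', g', nu') ->
  src nu = inf_rge x -> src nu' = inf_rge x' ->
  elementGGL S mu g nu x = elementGGL S mu' g' nu' x' ->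
  germ_rel S F (concat nu x) F' (concat nu' x').
Proof.
move=> SF Fn SF' Fn' nx n'x' e.
have ey : concat nu x = concat nu' x' by case: e.
split=> //.
have [u [u' [z [[/= nu_u n'u' eu _] uz u'z ex ex']]]] :=
  concat_common nx n'x' ey.
have mn := SGL_src SF Fn; have m'n' := SGL_src SF' Fn'.
have mu_u : src mu = rge (act S g u) by rewrite mn nu_u rge_act.
have mu'_u' : src mu' = rge (act S g' u') by rewrite m'n' n'u' rge_act.
have muz : src (comp mu (act S g u)) = inf_rge (inf_act S (cocycle S g u) z).
  by rewrite src_comp// (src_act_inf_rge _ _ uz).
have mu'z : src (comp mu' (act S g' u')) =
    inf_rge (inf_act S (cocycle S g' u') z).
  by rewrite src_comp// (src_act_inf_rge _ _ u'z).
(* After refinement the third parts coincide, so the Z-parts give equal degrees of the first parts.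
   Equality of the range paths then splits into equal first parts and equal tails. *)
move: e; rewrite ex ex' elementGGL_refine// elementGGL_refine//.
rewrite -eu => -[e1 e2 /(congr1 (fun f => f + toZ (deg (comp nu u)))%R)].
rewrite !subrK => /toZ_inj de.
have [em ez] := concat_inj muz mu'z de e1.
(* The cocycles agree from some [n0] on. The value at [n0] suffices: the triples are extended once
   more, by z(0, [n0]), and then become equal. *)
move: e2; rewrite -em => /Qtranslate_inj/QNG_eqP[n0 /(_ n0 (leN_refl _))].
rewrite /inf_cocycle => ec.
have ea : act S (cocycle S g u) (z 0%R n0) = act S (cocycle S g' u') (z 0%R n0).
  by rewrite -!inf_actE ez.
pose w := comp u (z 0%R n0); pose w' := comp u' (z 0%R n0).
have u_w : src u = rge (z 0%R n0) by rewrite rge_segment.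
have u'_w : src u' = rge (z 0%R n0) by rewrite rge_segment.
have nw : src nu = rge w by rewrite rge_comp.
have nw' : src nu' = rge w' by rewrite rge_comp.
have eww' : comp nu w = comp nu' w' by rewrite compA// compA// eu.
exists [set (comp nu w, 1%g, comp nu w)]; split.
- exact: idempotents_set1.
- exists (comp nu w); split => //.
  have [y zy ez'] := infpath_split z n0; exists y.
    by rewrite src_comp// src_comp.
  by rewrite {1}ez' /w !concat_comp// ?src_comp.
- have := @smul_set1r F mu g nu w 1%g (comp nu w) SF Fn nw.
  have := @smul_set1r F' mu' g' nu' w' 1%g (comp nu' w') SF' Fn' nw'.
  rewrite !act1 eww' => -> // -> //.
  rewrite !mulg1 !cocycle_comp// ec.
  have [c1 ->] := @act_comp _ _ _ S g _ _ u_w.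
  have [c2 ->] := @act_comp _ _ _ S g' _ _ u'_w.
  rewrite !compA// ?src_act_cocycle//.
  by rewrite em ea.
Qed.

(** The two previous lemmas identify [germ_rel] with equality of elements; its reflexivity, symmetry
    and transitivity are drawn from there. *)
Lemma germ_eqP F mu g nu x F' mu' g' nu' x' :
  SGL S F -> F (mu, g, nu) -> SGL S F' -> F' (mu', g', nu') ->
  src nu = inf_rge x -> src nu' = inf_rge x' ->
  germ S F (concat nu x) = germ S F' (concat nu' x') <->
  elementGGL S mu g nu x = elementGGL S mu' g' nu' x'.
Proof.
move=> SF Fn SF' Fn' nx n'x'; have mn := SGL_src SF Fn.
have m'n' := SGL_src SF' Fn'; split => [e|e].
  have : germ S F' (concat nu' x') (F', concat nu' x').
    split => //=; first by exists mu', g', nu'; split => //; exists x'.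
    exact: (elementGGL_germ_rel SF' Fn' SF' Fn').
  by rewrite -e => -[_ _]; exact: (germ_rel_elementGGL mn Fn SF' Fn').
apply/seteqP; split => -[F2 y] [/= SF2 dy r]; split => //=;
  have [mu2 [g2 [nu2 [Fn2 [x2 n2x2 ey]]]]] := dy; move: r; rewrite ey => r.
- apply: (elementGGL_germ_rel SF' Fn' SF2 Fn2) => //; rewrite -e.
  exact: (germ_rel_elementGGL mn Fn SF2 Fn2).
- apply: (elementGGL_germ_rel SF Fn SF2 Fn2) => //; rewrite e.
  exact: (germ_rel_elementGGL m'n' Fn' SF2 Fn2).
Qed.

(** Find the common extension of [nu] and [xi] along the image path, then pull the extension of [xi]
    and the tail back by the inverse of [h] to extend [eta] along [x]. *)
Lemma concat_common_act nu xi h eta x x' : src xi = act S h (src eta) ->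
  src nu = inf_rge x' -> src eta = inf_rge x ->
  concat nu x' = concat xi (inf_act S h x) -> exists u v z,
  [/\ Lmin nu xi (u, act S h v), src eta = rge v, src v = inf_rge z,
      x = concat v z &
      src u = inf_rge (inf_act S (cocycle S h v) z) /\
      x' = concat u (inf_act S (cocycle S h v) z)].
Proof.
move=> xe nx' ex exx'.
have xx : src xi = inf_rge (inf_act S h x) by rewrite inf_rge_act -ex.
have [u [w [t [uw ut wt ex' ehx]]]] := concat_common nx' xx exx'.
pose v := act S h^-1%g w; pose z := inf_act S (cocycle S h^-1%g w) t.
have hv : act S h v = w by rewrite actVK.
have zt : inf_act S (cocycle S h v) z = t.
  by rewrite -inf_actM -cocycleM mulgV cocycle1 inf_act1.
exists u, v, z; rewrite hv zt; split => //.
- have [/= _ xiw _ _] := uw.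
  by rewrite rge_act -xiw xe actK.
- exact: src_act_inf_rge.
- by rewrite -inf_act_concat// -ehx -inf_actM mulVg inf_act1.
Qed.

End Germs.

(** * Continuity tested on a subbase *)

Section Subbase.
Variables (T : topologicalType) (B : set (set T)).

(** This is the definition of open sets in a topology built from a subbase, so it holds by
    conversion for both groupoids. *)
Hypothesis open_subbase : forall A : set T, open A <->
  exists2 D, D `<=` finI_from B id & \bigcup_(C in D) C = A.

Lemma subbase_open A : B A -> open A.
Proof.
move=> BA; apply/open_subbase; exists [set A]; last by rewrite bigcup_set1.
by move=> _ ->; exact: (finI_from1 id).
Qed.

Lemma subbase_continuous (U : topologicalType) (f : U -> T) :
  (forall A, B A -> open (f @^-1` A)) -> continuous f.
Proof.
move=> fB; apply/continuousP => A /open_subbase[D DB <-].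
rewrite preimage_bigcup; apply: bigcup_open => C /DB[E EB <-].
rewrite preimage_bigcap bigcap_fset big_seq.
elim/big_ind : _ => [|P Q|C' C'E]; first exact: openT.
  exact: openI.
by apply: fB; have := EB _ C'E; rewrite inE.
Qed.

End Subbase.

(** * The isomorphism of topological groupoids *)

Section Isomorphism.
Variables (k : nat) (G : groupType) (L : kgraph k) (S : selfsimilar G L).

Lemma Gtight_subbase (A : set (Gtight S)) : open A <->
  exists2 D, D `<=` finI_from [set U | exists F mu g nu,
    [/\ SGL S F, F (mu, g, nu) & U = @tight_basic _ _ _ S F nu]] id &
  \bigcup_(C in D) C = A.
Proof. by []. Qed.

Lemma GGL_subbase (A : set (GGL S)) : open A <->
  exists2 D, D `<=` finI_from [set U | exists mu g nu,
    src mu = act S g (src nu) /\ U = @GGL_basic _ _ _ S mu g nu] id &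
  \bigcup_(C in D) C = A.
Proof. by []. Qed.

Lemma Gtight_triple (a : Gtight S) : exists F mu g nu x,
  [/\ SGL S F, F (mu, g, nu), src nu = inf_rge x &
      sval a = germ S F (concat nu x)].
Proof.
case: (svalP a) => F [y [SF [mu [g [nu [Fn [x nx ->]]]]] ->]].
by exists F, mu, g, nu, x.
Qed.

(** Surjectivity of psi: the singleton of the triple defining [e] lies in [SGL], and its germ is the
    preimage. *)
Lemma GGL_germ (e : GGL S) : exists a : Gtight S, exists F mu g nu x,
  [/\ SGL S F, F (mu, g, nu), src nu = inf_rge x,
      sval a = germ S F (concat nu x) & sval e = elementGGL S mu g nu x].
Proof.
case: (svalP e) => g [mu [nu [x [mn nx ->]]]].
have [a aE] : exists a : Gtight S,
    sval a = germ S [set (mu, g, nu)] (concat nu x).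
  suff h : is_germ S (germ S [set (mu, g, nu)] (concat nu x)).
    by exists (exist _ _ h).
  exists [set (mu, g, nu)], (concat nu x); split => //; first exact: SGL_set1.
  by exists mu, g, nu; split => //; exists x.
exists a, [set (mu, g, nu)], mu, g, nu, x; split => //; exact: SGL_set1.
Qed.

End Isomorphism.

Lemma sval_inj T (P : T -> Prop) : injective (@sval T P).
Proof. by move=> [x Px] [y Py] /= e; exact: eq_exist. Qed.

Theorem proposition7p2 (k : nat) (G : groupType) (L : kgraph k)
    (S : selfsimilar G L) (G_countable : countable [set: G])
    (L_row_finite : row_finite L) (L_source_free : source_free L)
    (S_pseudo_free : pseudo_free S) :
  (forall (F : set (triple G L)) (mu mu' nu : L) (g g' : G), SGL S F ->
     F (mu, g, nu) -> F (mu', g', nu) -> mu = mu' /\ g = g') /\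
  exists psi : Gtight S -> GGL S,
    [/\ forall (F : set (triple G L)) (mu : L) (g : G) (nu : L) (x : infpath L)
          (a : Gtight S),
          SGL S F -> F (mu, g, nu) -> src nu = inf_rge x ->
          sval a = germ S F (concat nu x) ->
          sval (psi a) = elementGGL S mu g nu x,
        exists psi' : GGL S -> Gtight S,
          [/\ cancel psi psi', cancel psi' psi, continuous psi &
              continuous psi'],
        forall a, GGL_rge (psi a) = tight_rge a,
        forall a, GGL_src (psi a) = tight_src a &
        forall a b c,
          tight_prod a b c <-> GGL_prod (psi a) (psi b) (psi c)].
Proof.
split=> [F mu mu' nu g g' SF Fn Fn'|].
  by have [] := SGL_uniq_prefix SF Fn Fn' (prefix_refl nu) (prefix_refl nu).
(* The value must serve all representatives of the germ at once, so the choice of psi includes its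
   well-definedness. *)
have /choice[psi psi_def] : forall a : Gtight S, exists e : GGL S,
    forall F mu g nu x, SGL S F -> F (mu, g, nu) -> src nu = inf_rge x ->
    sval a = germ S F (concat nu x) -> sval e = elementGGL S mu g nu x.
  move=> a; have [F [mu [g [nu [x [SF Fn nx aE]]]]]] := Gtight_triple a.
  have h : inGGL S (elementGGL S mu g nu x).
    by exists g, mu, nu, x; split => //; exact: (SGL_src SF Fn).
  exists (exist _ _ h) => F' mu' g' nu' x' SF' Fn' nx' /=.
  by rewrite aE => /(germ_eqP SF Fn SF' Fn' nx nx').
have psiP a F mu g nu x : SGL S F -> F (mu, g, nu) -> src nu = inf_rge x ->
    sval a = germ S F (concat nu x) <-> sval (psi a) = elementGGL S mu g nu x.
  move=> SF Fn nx; split; first exact: psi_def.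
  have [F' [mu' [g' [nu' [x' [SF' Fn' nx' aE]]]]]] := Gtight_triple a.
  rewrite (psi_def _ _ _ _ _ _ SF' Fn' nx' aE) aE => e.
  exact/(germ_eqP SF' Fn' SF Fn nx' nx).
exists psi.
have psi_inj : injective psi.
  move=> a b e; apply: sval_inj.
  have [F [mu [g [nu [x [SF Fn nx bE]]]]]] := Gtight_triple b.
  rewrite bE; apply/(psiP _ _ _ _ _ _ SF Fn nx).
  by rewrite e (psi_def _ _ _ _ _ _ SF Fn nx bE).
have /choice[psi' psiK'] : forall e, exists a, psi a = e.
  move=> e; have [a [F [mu [g [nu [x [SF Fn nx aE eE]]]]]]] := GGL_germ e.
  exists a; apply: sval_inj.
  by rewrite eE (psi_def _ _ _ _ _ _ SF Fn nx aE).
(* This identity yields both continuity statements: each subbasic set of either groupoid occurs in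
   it, taking a singleton for [F] when only a triple is given. *)
have basicE F mu g nu : SGL S F -> F (mu, g, nu) ->
    psi @^-1` (@GGL_basic _ _ _ S mu g nu) = @tight_basic _ _ _ S F nu.
  move=> SF Fn; apply/seteqP; split => a [x nx aE]; exists x => //.
    exact/(psiP _ _ _ _ _ _ SF Fn nx).
  exact/(psiP _ _ _ _ _ _ SF Fn nx).
have rgeE a : GGL_rge (psi a) = tight_rge a.
  rewrite /tight_rge; case: (Gtight_rep a) => -[F y] /= [SF].
  move=> [mu [g [nu [Fn [x nx ->]]]]] aE.
  by rewrite (thetaE SF Fn nx) /GGL_rge (psi_def _ _ _ _ _ _ SF Fn nx aE).
have srcE a : GGL_src (psi a) = tight_src a.
  rewrite /tight_src; case: (Gtight_rep a) => -[F y] /= [SF].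
  move=> [mu [g [nu [Fn [x nx ->]]]]] aE.
  by rewrite /GGL_src (psi_def _ _ _ _ _ _ SF Fn nx aE).
split => //; first by move=> F mu g nu x a; exact: psi_def.
- exists psi'; split => //.
  + by move=> a; apply: psi_inj; rewrite psiK'.
  + apply: (subbase_continuous (@GGL_subbase _ _ _ S)).
    move=> _ [mu [g [nu [mn ->]]]].
    rewrite (basicE [set (mu, g, nu)])//; last exact: SGL_set1.
    apply: (subbase_open (@Gtight_subbase _ _ _ S)).
    by exists [set (mu, g, nu)], mu, g, nu; split => //; exact: SGL_set1.
  + apply: (subbase_continuous (@Gtight_subbase _ _ _ S)).
    move=> _ [F [mu [g [nu [SF Fn ->]]]]]; rewrite -(basicE _ _ _ _ SF Fn).
    rewrite -comp_preimage (_ : psi \o psi' = id); last exact/funext.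
    apply: (subbase_open (@GGL_subbase _ _ _ S)).
    by exists mu, g, nu; split => //; exact: SGL_src SF Fn.
- move=> a b c; split.
    move=> [F' [F [y [[SF' [mu [g [nu [Fn [x' nx' exx']]]]]]
      [SF [xi [h [eta [Fx [x ex ey]]]]]] aE bE cE]]]].
    rewrite {}ey in exx' aE bE cE *.
    rewrite exx' in aE; rewrite (thetaE SF Fx ex) in exx'.
    have xe := SGL_src SF Fx; have mn := SGL_src SF' Fn.
    have [u [v [z [uv eta_v vz xE [uz x'E]]]]] :=
      concat_common_act xe nx' ex (esym exx').
    have [/= nu_u xi_v euv _] := uv.
    (* The value of psi at [c] is computed from a representative [F2] known to lie in [SGL], and
       compared with [smul F' F] through [germ_rel]. That comparison asks only for one suitable
       triple of the product. *)
    have [F2 [mu2 [g2 [nu2 [x2 [SF2 Fn2 nx2 cE2]]]]]] := Gtight_triple c.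
    have Pt : smul S F' F (comp mu (act S g u),
        (cocycle S g u * cocycle S h v)%g, comp eta v).
      exists mu, g, nu, xi, h, eta, u, (act S h v); split => //.
      by rewrite actK.
    have muu : src mu = rge (act S g u) by rewrite mn nu_u rge_act.
    have evz : src (comp eta v) = inf_rge z by rewrite src_comp.
    have r : germ_rel S (smul S F' F) (concat (comp eta v) z)
        F2 (concat nu2 x2).
      have : germ S F2 (concat nu2 x2) (F2, concat nu2 x2).
        split => //=; first by exists mu2, g2, nu2; split => //; exists x2.
        exact: (elementGGL_germ_rel SF2 Fn2 SF2 Fn2).
      by rewrite -cE2 cE xE -concat_comp// => -[].
    have cc : src (comp mu (act S g u)) =
        act S (cocycle S g u * cocycle S h v)%g (src (comp eta v)).
      by rewrite !src_comp// actM src_act_cocycle uz inf_rge_act vz.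
    have pc := psi_def _ _ _ _ _ _ SF2 Fn2 nx2 cE2.
    have := germ_rel_elementGGL cc Pt SF2 Fn2 evz nx2 r; rewrite -pc => {}pc.
    have pa := psi_def _ _ _ _ _ _ SF' Fn nx' aE.
    have pb := psi_def _ _ _ _ _ _ SF Fx ex bE.
    split; first by rewrite /GGL_src /GGL_rge pa pb /= exx'.
    rewrite /GGL_src /GGL_rge pa pb -pc.
    by rewrite x'E xE -(elementGGL_mul_refine mn xe).
  move=> [].
  have [F' [mu [g [nu [x' [SF' Fn nx' aE]]]]]] := Gtight_triple a.
  have [F [xi [h [eta [x [SF Fx ex bE]]]]]] := Gtight_triple b.
  have pa := psi_def _ _ _ _ _ _ SF' Fn nx' aE.
  have pb := psi_def _ _ _ _ _ _ SF Fx ex bE.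
  have xe := SGL_src SF Fx; have mn := SGL_src SF' Fn.
  rewrite /GGL_src /GGL_rge pa pb /= => exx' cE.
  have [u [v [z [uv eta_v vz xE [uz x'E]]]]] :=
    concat_common_act xe nx' ex exx'.
  have [/= nu_u xi_v euv _] := uv.
  (* Extended to the common inner path [nu1], the triples represent [a] and [b] by singletons, whose
     product is again a singleton by [smul_set1]. *)
  pose M := comp mu (act S g u); pose nu1 := comp nu u; pose N := comp eta v.
  pose t := inf_act S (cocycle S h v) z.
  have Mnu1 : src M = act S (cocycle S g u) (src nu1).
    by rewrite !src_comp ?src_act_cocycle// mn nu_u rge_act.
  have nu1N : src nu1 = act S (cocycle S h v) (src N).
    by rewrite !src_comp// uz inf_rge_act vz.
  have nu1t : src nu1 = inf_rge t by rewrite src_comp.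
  have Nz : src N = inf_rge z by rewrite src_comp.
  have thE : theta S [set (nu1, cocycle S h v, N)] (concat N z) = concat nu1 t.
    by apply: thetaE => //; exact: SGL_set1.
  exists [set (M, cocycle S g u, nu1)], [set (nu1, cocycle S h v, N)].
  exists (concat N z).
  rewrite thE smul_set1//; split.
  + split; first exact: SGL_set1.
    by exists M, (cocycle S g u), nu1; split => //; exists t.
  + split; first exact: SGL_set1.
    by exists nu1, (cocycle S h v), N; split => //; exists z.
  + apply/(psiP _ _ _ _ _ _ (SGL_set1 Mnu1) erefl nu1t).
    by rewrite pa x'E elementGGL_refine.
  + apply/(psiP _ _ _ _ _ _ (SGL_set1 nu1N) erefl Nz).
    by rewrite pb xE elementGGL_refine// /nu1 euv.
  + have MN : src M = act S (cocycle S g u * cocycle S h v)%g (src N).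
      by rewrite actM -nu1N.
    apply/(psiP _ _ _ _ _ _ (SGL_set1 MN) erefl Nz).
    by rewrite cE x'E xE elementGGL_mul_refine.
Qed.
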